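(* Let $d\ge2$, let $\Omega\subset\mathbb{R}^d$ be compact, let $X_1,X_2,\ldots$ be i.i.d. in $\Omega$ with density $\varphi_P$, and $Y_1,Y_2,\ldots$ i.i.d. in $\Omega$ with density $\varphi_D$, all independent. Let $L^*(n)$ be the length of the optimal stacker crane tour through the pairs $(X_i,Y_i)$, $i=1,\ldots,n$. Then $$\liminf_{n\to\infty}\frac{L^*(n)}{n}\ge \mathbb{E}_{\varphi_P\varphi_D}\|Y-X\|+W(\varphi_D,\varphi_P)\quad\text{almost surely},$$ where $X$ and $Y$ are independent with densities $\varphi_P$ and $\varphi_D$ respectively.
   Context: Given pickup/delivery pairs $(x_i,y_i)$, a stacker crane tour is a closed tour through all $x_i,y_i$ in which each pickup $x_i$ is immediately followed by its delivery $y_i$; its length is the sum of Euclidean distances along the tour. The Euclidean Wasserstein distance is $W(\varphi_1,\varphi_2)=\inf_{\gamma\in\Gamma(\varphi_1,\varphi_2)}\int_{\Omega\times\Omega}\|y-x\|\,d\gamma(x,y)$, with $\Gamma(\varphi_1,\varphi_2)$ the set of measures on $\Omega\times\Omega$ with marginal densities $\varphi_1,\varphi_2$. The densities are densities of absolutely continuous distributions. *)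

(* Defs.v *)
From HB Require Import structures.
From mathcomp Require Import all_boot all_order all_algebra.
From mathcomp Require Import all_classical all_reals all_analysis.
From mathcomp Require Import fingroup perm.

Set Implicit Arguments.
Unset Strict Implicit.
Unset Printing Implicit Defensive.

Import Order.TTheory GRing.Theory Num.Theory.
Import numFieldNormedType.Exports.
Local Open Scope classical_set_scope.
Local Open Scope ring_scope.

Definition box (R : realType) (d : nat) (a b : 'rV[R]_d) : set 'rV[R]_d :=
  [set x | forall i : 'I_d, a 0 i <= x 0 i <= b 0 i].

Definition boxes (R : realType) (d : nat) : set (set 'rV[R]_d) :=
  [set B | exists a b : 'rV[R]_d, B = box a b].

(* R^d equipped with the sigma-algebra generated by boxes (= Borel sets) *)
Definition Rd (R : realType) (d : nat) := g_sigma_algebraType (@boxes R d).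

Definition eucl (R : realType) (d : nat) (x y : 'rV[R]_d) : R :=
  Num.sqrt (\sum_(i < d) (y 0 i - x 0 i) ^+ 2).

(* lam is (the) d-dimensional Lebesgue measure on the Borel sets of R^d:
   it gives every box its volume (this determines it uniquely). *)
Definition is_lebesgue (R : realType) (d : nat)
    (lam : {measure set (Rd R d) -> \bar R}) : Prop :=
  forall a b : 'rV[R]_d, (forall i, a 0 i <= b 0 i) ->
    lam (box a b) = (\prod_(i < d) (b 0 i - a 0 i))%:E.

Definition is_density_on (R : realType) (d : nat)
    (lam : {measure set (Rd R d) -> \bar R}) (Omega : set (Rd R d))
    (phi : Rd R d -> R) : Prop :=
  [/\ measurable_fun setT phi,
      (forall x, 0 <= phi x),
      (forall x, ~ Omega x -> phi x = 0)
    & (\int[lam]_x (phi x)%:E = 1)%E].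

Definition has_density (R : realType) (d : nat) (dT : measure_display)
    (T : measurableType dT) (P : probability T R)
    (lam : {measure set (Rd R d) -> \bar R}) (phi : Rd R d -> R)
    (Z : T -> Rd R d) : Prop :=
  measurable_fun setT Z /\
  forall A : set (Rd R d), measurable A ->
    P (Z @^-1` A) = (\int[lam]_(x in A) (phi x)%:E)%E.

Definition mutually_independent (R : realType) (d : nat) (dT : measure_display)
    (T : measurableType dT) (P : probability T R) (I : eqType)
    (Z : I -> T -> Rd R d) : Prop :=
  forall (J : seq I) (A : I -> set (Rd R d)), uniq J ->
    (forall j, measurable (A j)) ->
    P (\big[setI/setT]_(j <- J) (Z j @^-1` A j)) =
      (\prod_(j <- J) P (Z j @^-1` A j))%E.

Definition mean_dist (R : realType) (d : nat)
    (lam : {measure set (Rd R d) -> \bar R}) (phiP phiD : Rd R d -> R) : \bar R :=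
  (\int[lam]_x \int[lam]_y (eucl x y * phiP x * phiD y)%:E)%E.

(* couplings: measures gamma on R^d x R^d with marginal densities phi1, phi2
   (hence concentrated on Omega x Omega when phi1, phi2 are supported in Omega) *)
Definition is_coupling (R : realType) (d : nat)
    (lam : {measure set (Rd R d) -> \bar R}) (phi1 phi2 : Rd R d -> R)
    (gamma : {measure set (Rd R d * Rd R d)%type -> \bar R}) : Prop :=
  (forall A : set (Rd R d), measurable A ->
     gamma (A `*` setT) = (\int[lam]_(x in A) (phi1 x)%:E)%E) /\
  (forall B : set (Rd R d), measurable B ->
     gamma (setT `*` B) = (\int[lam]_(y in B) (phi2 y)%:E)%E).

Definition wasserstein (R : realType) (d : nat)
    (lam : {measure set (Rd R d) -> \bar R}) (phi1 phi2 : Rd R d -> R) : \bar R :=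
  ereal_inf [set (\int[gamma]_z (eucl z.1 z.2)%:E)%E
            | gamma in is_coupling lam phi1 phi2].

(* Stacker crane tours: the n pairs are served in the cyclic order given by
   s : 'S_n; the tour is x_{s0} y_{s0} x_{s1} y_{s1} ... y_{s(n-1)} (x_{s0}). *)
Definition sc_tour_length (R : realType) (d : nat) (n : nat)
    (x y : nat -> 'rV[R]_d) (s : 'S_n) : R :=
  \sum_(k < n) (eucl (x (s k)) (y (s k)) + eucl (y (s k)) (x (s (ordS k)))).

Definition sc_opt (R : realType) (d : nat) (n : nat)
    (x y : nat -> 'rV[R]_d) : R :=
  \big[Num.min/sc_tour_length x y (1%g : 'S_n)]_(s : 'S_n) sc_tour_length x y s.

(* Main.v *)
Require Import Defs.
From HB Require Import structures.
From mathcomp Require Import all_boot all_order all_algebra.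
From mathcomp Require Import all_classical all_reals all_analysis.
From mathcomp Require Import fingroup perm.
From mathcomp Require Import ring lra zify measurable_realfun.
Import Order.TTheory GRing.Theory Num.Theory.
Import numFieldNormedType.Exports.
Local Open Scope classical_set_scope.
Local Open Scope ring_scope.

(** In a tour every pickup-delivery leg is traversed once, and the empty legs
    match each delivery to the next pickup, so a tour through [n] pairs costs
    [\sum_i |Y_i - X_i|] plus the cost of a perfect matching from the
    deliveries to the pickups. Cut [Omega] into finitely many cells of small
    diameter: up to a small error both terms depend only on which cells the
    points fall in. By the strong law for events, the empirical frequencies of
    pairs of cells converge to products of cell probabilities, so the first
    term tends to the mean distance. The matching induces a transport plan
    between the empirical cell frequencies; these are close to the cell
    probabilities, so a small modification of the plan has exactly the right
    marginals and is realised, blockwise by product measures, as a coupling of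
    the two densities. Its cost is at least the Wasserstein distance. *)

(** * A strong law of large numbers for pairwise independent events *)

Lemma integral_sum_indic (dT : measure_display) (T : measurableType dT)
    (R : realType) (P : probability T R) (I : Type) (s : seq I) (E : I -> set T) :
  (forall i, measurable (E i)) ->
  (\int[P]_w (\sum_(i <- s) \1_(E i) w : R)%:E = \sum_(i <- s) P (E i))%E.
Proof.
move=> mE; under eq_integral do rewrite -sumEFin.
rewrite ge0_integral_sum//.
- by apply: eq_bigr => i _; rewrite integral_indic// setIT.
- by move=> i; apply/measurable_EFinP; exact: measurable_indic.
Qed.

Definition count_events {T : Type} {R : realType} (E : nat -> set T)
    (n : nat) (w : T) : R := \sum_(i < n) \1_(E i) w.

Section slln.
Context (dT : measure_display) (T : measurableType dT) (R : realType).
Variables (P : probability T R) (E : nat -> set T) (p : R).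
Hypothesis mE : forall i, measurable (E i).
Hypothesis PE : forall i, P (E i) = p%:E.
Hypothesis PEE : forall i j, i != j -> P (E i `&` E j) = (p ^+ 2)%:E.

Local Notation N := (@count_events T R E).

Let p01 : 0 <= p <= 1.
Proof. by rewrite -!lee_fin -(PE 0) measure_ge0 probability_le1. Qed.

Let measurable_N n : measurable_fun setT (N n).
Proof. by apply: measurable_sum => i; exact: measurable_indic. Qed.

Let N_ge0 n w : 0 <= N n w.
Proof. by apply: sumr_ge0 => i _; rewrite indicE ler0n. Qed.

(** The variance of a sum of pairwise independent indicators: in the second moment the [n] diagonal
    pairs contribute [p] each and the [n * (n - 1)] others [p ^+ 2] each. *)
Lemma integral_count_sqr n :
  (\int[P]_w ((N n w - n%:R * p) ^+ 2)%:E = (n%:R * (p * (1 - p)))%:E)%E.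
Proof.
have /andP[p0 p1] := p01.
have iN : (\int[P]_w (N n w)%:E = (n%:R * p)%:E)%E.
  rewrite integral_sum_indic//.
  under eq_bigr do rewrite PE.
  by rewrite sumEFin sumr_const card_ord mulr_natl.
have iN2 : (\int[P]_w (N n w ^+ 2)%:E =
    (n%:R * p + n%:R * (n%:R - 1) * p ^+ 2)%:E)%E.
  transitivity (\int[P]_w (\sum_(ij : 'I_n * 'I_n)
      \1_(E ij.1 `&` E ij.2) w : R)%:E)%E.
    apply: eq_integral => w _; congr _%:E.
    rewrite expr2 mulr_suml.
    under eq_bigr do rewrite mulr_sumr.
    rewrite pair_bigA/=; apply: eq_bigr => ij _.
    by rewrite indicI.
  rewrite integral_sum_indic; last by move=> ij; exact: measurableI.
  rewrite -(pair_bigA _ (fun i j : 'I_n => P (E i `&` E j)))/=.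
  transitivity (\sum_(i < n) (p + (n%:R - 1) * p ^+ 2)%:E)%E; last first.
    rewrite sumEFin sumr_const card_ord; congr _%:E.
    by rewrite -[LHS]mulr_natl; ring.
  apply: eq_bigr => i _.
  rewrite (bigD1 i)//= setIid PE.
  under eq_bigr => j ji do rewrite PEE 1?eq_sym//.
  rewrite sumEFin sumr_const; congr _%:E; congr (_ + _).
  rewrite -[LHS]mulr_natl; congr (_ * _).
  have -> : #|[pred j : 'I_n | j != i]| = n.-1.
    by rewrite -[X in _ = X.-1](card_ord n) -(cardC1 i); apply: eq_card.
  have n0 : (0 < n)%N by exact: leq_ltn_trans (ltn_ord i).
  by rewrite -[in RHS](prednK n0) -natr1 addrK.
have mS : measurable_fun setT (fun w => (N n w - n%:R * p) ^+ 2).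
  by apply: measurable_funX; apply: measurable_funB => //; exact: measurable_N.
(* The square is expanded with its cross term moved to the left, so that only integrals of
   nonnegative functions are added. *)
have : (\int[P]_w ((N n w - n%:R * p) ^+ 2)%:E + (2 * (n%:R * p) ^+ 2)%:E =
        \int[P]_w (N n w ^+ 2)%:E + ((n%:R * p) ^+ 2)%:E)%E.
  have c0 : 0 <= 2 * (n%:R * p) by rewrite mulr_ge0// mulr_ge0.
  have -> : ((2 * (n%:R * p) ^+ 2)%:E =
      \int[P]_w ((2 * (n%:R * p))%:E * (N n w)%:E))%E.
    rewrite ge0_integralZl_EFin//.
    - by rewrite iN -EFinM; congr _%:E; ring.
    - by move=> w _; rewrite lee_fin.
    - by apply/measurable_EFinP; exact: measurable_N.
  have -> : (((n%:R * p) ^+ 2)%:E = \int[P]_w ((n%:R * p) ^+ 2)%:E)%E.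
    by rewrite integral_cst// [X in (_ * X)%E]probability_setT mule1.
  rewrite -!ge0_integralD//.
  - by apply: eq_integral => w _; rewrite -EFinM -!EFinD; congr _%:E; ring.
  - by move=> w _; rewrite lee_fin sqr_ge0.
  - by apply/measurable_EFinP/measurable_funX; exact: measurable_N.
  - by move=> w _; rewrite lee_fin sqr_ge0.
  - by move=> w _; rewrite lee_fin sqr_ge0.
  - exact/measurable_EFinP.
  - by move=> w _; rewrite -EFinM lee_fin mulr_ge0.
  - by apply: emeasurable_funM => //; apply/measurable_EFinP; exact: measurable_N.
rewrite iN2 -EFinD => /esym/eqP; rewrite -sube_eq ?fin_num_adde_defl//.
by move=> /eqP <-; rewrite -EFinB; congr _%:E; ring.
Qed.

(* Along the squares the variances of the empirical means are summable. *)
Let dev k w : R := (N (k.+1 ^ 2) w - (k.+1 ^ 2)%:R * p) / (k.+1 ^ 2)%:R.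

Let measurable_dev k : measurable_fun setT (fun w => dev k w ^+ 2).
Proof.
apply: measurable_funX; apply: measurable_funM => //.
by apply: measurable_funB => //; exact: measurable_N.
Qed.

(** A mean of [(k + 1)^2] indicators has variance [p * (1 - p) / (k + 1)^2], and
    [p * (1 - p) <= 1]. *)
Lemma integral_dev_sqr k :
  (\int[P]_w (dev k w ^+ 2)%:E <= (harmonic k ^+ 2)%:E)%E.
Proof.
have /andP[p0 p1] := p01.
have k0 : (k.+1 ^ 2)%:R != 0 :> R by rewrite pnatr_eq0 expn_eq0.
under eq_integral do rewrite expr_div_n mulrC EFinM.
rewrite ge0_integralZl_EFin//.
- rewrite integral_count_sqr -EFinM lee_fin /harmonic.
  have -> : ((k.+1 ^ 2)%:R ^+ 2)^-1 * ((k.+1 ^ 2)%:R * (p * (1 - p))) =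
    (p * (1 - p)) * (k.+1%:R^-1 ^+ 2) :> R.
    by rewrite exprVn -natrX; field.
  rewrite -[leRHS]mul1r ler_wpM2r// ?sqr_ge0//; nra.
- by move=> w _; rewrite lee_fin sqr_ge0.
- apply/measurable_EFinP/measurable_funX/measurable_funB => //.
Qed.

Lemma sum_harmonic_sqr n : \sum_(0 <= k < n) harmonic k ^+ 2 <= 2 :> R.
Proof.
case: n => [|n]; first by rewrite big_nil.
(* The strengthened bound passes through the induction because
   [1 / (x + 1)^2 <= 1 / x - 1 / (x + 1)]. *)
suff : \sum_(0 <= k < n.+1) harmonic k ^+ 2 <= 2 - harmonic n :> R.
  by move/le_trans; apply; rewrite gerBl harmonic_ge0.
elim: n => [|n ih]; first by rewrite big_nat1 /harmonic/= invr1 expr1n; lra.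
rewrite big_nat_recr//=; apply: le_trans (lerD ih (lexx _)) _.
rewrite /harmonic/=.
set x : R := n.+1%:R; have x1 : 1 <= x by rewrite ler1n.
have xE : n.+2%:R = x + 1 :> R by rewrite natr1.
rewrite -subr_ge0 xE.
have -> : 2 - (x + 1)^-1 - (2 - x^-1 + (x + 1)^-1 ^+ 2) =
  x^-1 * (x + 1)^-1 ^+ 2 by field; apply/andP; split; lra.
by rewrite mulr_ge0 ?sqr_ge0// invr_ge0; lra.
Qed.

(** The series of squared deviations has integral at most [2], so it is almost surely finite and its
    terms tend to [0]. *)
Lemma dev_cvg0 : {ae P, forall w, dev k w @[k --> \oo] --> 0}.
Proof.
pose g k w : \bar R := (dev k w ^+ 2)%:E.
have g0 k w : (0 <= g k w)%E by rewrite lee_fin sqr_ge0.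
have mg k : measurable_fun setT (g k) by exact/measurable_EFinP.
have fin : (\int[P]_w (\sum_(k <oo) g k w) < +oo)%E.
  rewrite integral_nneseries//.
  apply: (@le_lt_trans _ _ 2%:E); last exact: ltry.
  apply: lime_le.
    by apply: is_cvg_nneseries => k _ _; exact: integral_ge0.
  near=> n.
  apply: (@le_trans _ _ (\sum_(0 <= k < n) (harmonic k ^+ 2)%:E)%E).
    by apply: lee_sum => k _; exact: integral_dev_sqr.
  by rewrite sumEFin lee_fin sum_harmonic_sqr.
have int : P.-integrable setT (fun w => \sum_(k <oo) g k w)%E.
  apply/integrableP; split; first exact: ge0_emeasurable_sum.
  rewrite (eq_integral (fun w => \sum_(k <oo) g k w)%E)// => w _.
  by rewrite gee0_abs// nneseries_ge0.
have := integrable_ae measurableT int.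
apply: filterS => w /(_ I) finw.
(* Each term lies between [0] and the tail of the series that starts at it. *)
have gcv : g k w @[k --> \oo] --> 0%E.
  apply: (@squeeze_cvge _ _ _ _ (cst 0%E) (g ^~ w)
      (fun k => \sum_(k <= j <oo) g j w)%E).
  - near=> k; rewrite g0/=.
    have := @nneseries_lim_ge R (g ^~ w) xpredT k k.+1 (fun _ _ _ => g0 _ _).
    by rewrite big_nat1.
  - exact: cvg_cst.
  - by apply: nneseries_tail_cvg => //; rewrite ltey_eq finw.
have {}gcv : dev k w ^+ 2 @[k --> \oo] --> 0.
  by move/fine_cvgP : gcv => [].
have : Num.sqrt (dev k w ^+ 2) @[k --> \oo] --> (0 : R).
  by have := cvg_comp _ _ gcv (@sqrt_continuous R 0); rewrite sqrtr0.
move=> h; apply/norm_cvg0P.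
by under eq_fun do rewrite -sqrtr_sqr.
Unshelve. all: by end_near.
Qed.

(** One more event changes the centred count by [1 - p] or [- p], hence by at most [1] in absolute
    value. *)
Lemma count_dev_le m n w : (m <= n)%N ->
  `|N n w - n%:R * p| <= `|N m w - m%:R * p| + (n - m)%:R.
Proof.
have /andP[p0 p1] := p01.
move=> mn; rewrite -{1 2}(subnKC mn); elim: (n - m)%N => [|j ih].
  by rewrite addn0 addr0.
rewrite addnS /count_events big_ord_recr/= -/(N _ w) -!natr1.
have -> : N (m + j) w + \1_(E (m + j)) w - ((m + j)%:R + 1) * p =
  (N (m + j) w - (m + j)%:R * p) + (\1_(E (m + j)) w - p) by ring.
rewrite [leRHS]addrA; apply: le_trans (ler_normD _ _) _; apply: lerD => //.
rewrite indicE; case: (_ \in _); rewrite /= ler_norml; apply/andP; split; lra.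
Qed.

(** Convergence along the squares extends to all [n]: the gap from the last square [(k + 1)^2] below
    [n] is at most [2 * (k + 1)], which is negligible against [(k + 1)^2]. *)
Lemma slln_events : {ae P, forall w, N n w / n%:R @[n --> \oo] --> p}.
Proof.
apply: filterS dev_cvg0 => w cv.
apply/cvgrPdist_le => e e0.
have e20 : 0 < e / 2 by rewrite divr_gt0.
have [K1 _ hK1] : \forall k \near \oo, `|dev k w| <= e / 2.
  by move/cvgrPdist_le : cv => /(_ _ e20); apply: filterS => k; rewrite sub0r normrN.
(* The bound [e / 4] makes the gap [2 * (k + 1)] at most [(k + 1)^2 * (e / 2)], the other half of
   the error. *)
have [K2 _ hK2] : \forall k \near \oo, harmonic k <= e / 4 :> R.
  have e40 : 0 < e / 4 by rewrite divr_gt0.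
  have /cvgrPdist_le/(_ _ e40) := @cvg_harmonic R.
  by apply: filterS => k; rewrite sub0r normrN ger0_norm// harmonic_ge0.
exists ((maxn K1 K2).+1 ^ 2)%N => // n /= hn.
have exk : exists k, (k.+1 ^ 2 <= n)%N by exists (maxn K1 K2).
have ub k : (k.+1 ^ 2 <= n)%N -> (k <= n)%N.
  by move/(leq_trans _); apply; rewrite (leq_trans (leqnSn k))// leq_pmull.
have [k kn kmax] := ex_maxnP exk ub.
have Kk := kmax _ hn.
have nk : (n < k.+2 ^ 2)%N by rewrite ltnNge; apply/negP => /kmax; rewrite ltnn.
have n0 : 0 < n%:R :> R by rewrite ltr0n (leq_trans _ kn)// expn_gt0.
have k0 : 0 < (k.+1 ^ 2)%:R :> R by rewrite ltr0n expn_gt0.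
rewrite distrC.
have -> : N n w / n%:R - p = (N n w - n%:R * p) / n%:R.
  by rewrite mulrBl mulrAC mulfV ?mul1r// gt_eqF.
rewrite normrM normfV (gtr0_norm n0) ler_pdivrMr//.
apply: le_trans (count_dev_le _ _ w kn) _.
apply: (@le_trans _ _ ((k.+1 ^ 2)%:R * e)); last first.
  by rewrite mulrC ler_pM2l// ler_nat.
have d1 : `|N (k.+1 ^ 2) w - (k.+1 ^ 2)%:R * p| <= (k.+1 ^ 2)%:R * (e / 2).
  have := hK1 k (leq_trans (leq_maxl _ _) Kk).
  by rewrite /dev normrM normfV (gtr0_norm k0) ler_pdivrMr// [leRHS]mulrC.
have d2 : (n - k.+1 ^ 2)%:R <= 2 * k.+1%:R :> R.
  rewrite -natrM ler_nat; lia.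
have d3 : 2 * k.+1%:R <= (k.+1 ^ 2)%:R * (e / 2) :> R.
  have := hK2 k (leq_trans (leq_maxr _ _) Kk).
  rewrite /harmonic/= natrX -[_^-1]div1r ler_pdivrMr// => h.
  have : 0 < k.+1%:R :> R by [].
  nra.
lra.
Qed.

End slln.

(** * Euclidean distance and partitions into small cells *)

(** Lagrange's identity: twice the difference of the two sides is a sum of squares over ordered
    pairs of indices. *)
Lemma sum_cauchy_schwarz (R : realDomainType) (n : nat) (a b : 'I_n -> R) :
  (\sum_i a i * b i) ^+ 2 <= (\sum_i a i ^+ 2) * (\sum_i b i ^+ 2).
Proof.
rewrite -subr_ge0 -(pmulr_lge0 _ (ltr0n R 2)).
suff -> : ((\sum_i a i ^+ 2) * (\sum_i b i ^+ 2) - (\sum_i a i * b i) ^+ 2) * 2 =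
    \sum_i \sum_j (a i * b j - a j * b i) ^+ 2.
  by apply: sumr_ge0 => i _; apply: sumr_ge0 => j _; exact: sqr_ge0.
set SA := \sum_i a i ^+ 2; set SB := \sum_i b i ^+ 2; set SC := \sum_i a i * b i.
have inner i : \sum_j (a i * b j - a j * b i) ^+ 2 =
    a i ^+ 2 * SB + b i ^+ 2 * SA - a i * b i * (SC * 2).
  rewrite /SA /SB /SC mulr_suml !mulr_sumr -sumrN -!big_split/=.
  by apply: eq_bigr => j _; ring.
under [RHS]eq_bigr do rewrite inner.
by rewrite !big_split/= sumrN -!mulr_suml -/SA -/SB -/SC; ring.
Qed.

Section eucl.
Context (R : realType) (d : nat).
Implicit Types x y z : 'rV[R]_d.

Lemma eucl_ge0 x y : 0 <= eucl x y.
Proof. exact: sqrtr_ge0. Qed.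

Lemma eucl_sym x y : eucl x y = eucl y x.
Proof. by congr Num.sqrt; apply: eq_bigr => i _; rewrite -sqrrN opprB. Qed.

Lemma eucl_triangle x y z : eucl x z <= eucl x y + eucl y z.
Proof.
rewrite -ler_sqr ?nnegrE ?addr_ge0 ?eucl_ge0// sqrrD.
have sq u v : eucl u v ^+ 2 = \sum_(i < d) (v 0 i - u 0 i) ^+ 2.
  by rewrite sqr_sqrtr// sumr_ge0// => i _; exact: sqr_ge0.
have cs : \sum_(i < d) (y 0 i - x 0 i) * (z 0 i - y 0 i) <= eucl x y * eucl y z.
  apply: le_trans (ler_norm _) _.
  rewrite -ler_sqr ?nnegrE ?mulr_ge0 ?eucl_ge0// real_normK ?num_real//.
  by rewrite exprMn !sq; exact: sum_cauchy_schwarz.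
rewrite [in leLHS]sq.
have -> : \sum_(i < d) (z 0 i - x 0 i) ^+ 2 =
    eucl x y ^+ 2 + (\sum_(i < d) (y 0 i - x 0 i) * (z 0 i - y 0 i)) *+ 2
    + eucl y z ^+ 2.
  rewrite !sq -sumrMnl -!big_split/=; apply: eq_bigr => i _; ring.
by rewrite lerD2r lerD2l lerMn2r.
Qed.

Lemma eucl_le_coord x y h : 0 <= h -> (forall i, `|y 0 i - x 0 i| <= h) ->
  eucl x y <= d%:R * h.
Proof.
move=> h0 xy; have dh0 : 0 <= d%:R * h by rewrite mulr_ge0.
rewrite -[leRHS](ger0_norm dh0) -sqrtr_sqr ler_sqrt ?sqr_ge0//.
apply: (@le_trans _ _ (\sum_(i < d) h ^+ 2)).
  apply: ler_sum => i _; rewrite -real_normK ?num_real//.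
  by rewrite ler_sqr ?nnegrE.
rewrite sumr_const card_ord -[leLHS]mulr_natl exprMn ler_wpM2r ?sqr_ge0//.
by rewrite -natrX ler_nat; nia.
Qed.

(** The sigma-algebra is generated by bounded boxes, so a closed half-space is exhausted by boxes
    that share its face [x 0 i = r] and grow in all other directions. *)
Lemma measurable_coord i : measurable_fun setT (fun x : Rd R d => x 0 i).
Proof.
apply: (measurability (@RGenCInfty.G R)); first exact: RGenCInfty.measurableE.
move=> _ [_ [r ->] <-]; rewrite setTI.
pose a n : 'rV[R]_d := \row_j (if j == i then r else - n%:R).
pose b n : 'rV[R]_d := const_mx n%:R.
rewrite (_ : _ @^-1` _ = \bigcup_n box (a n) (b n)).
  apply: bigcupT_measurable => n; apply: sub_sigma_algebra.
  by exists (a n), (b n).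
apply/seteqP; split => x /=; rewrite in_itv/= andbT.
  move=> rx; pose m := Num.bound (\sum_j `|x 0 j|).
  exists m => // j; rewrite !mxE.
  have : `|x 0 j| <= m%:R.
    apply: (@le_trans _ _ (\sum_j `|x 0 j|)).
      by rewrite (bigD1 j)//= lerDl sumr_ge0.
    by rewrite ltW// archi_boundP// sumr_ge0.
  rewrite ler_norml => /andP[m1 m2]; rewrite m2 andbT.
  by case: eqP => [->|_].
by move=> [n _ /(_ i)]; rewrite !mxE eqxx => /andP[].
Qed.

Lemma measurable_eucl :
  measurable_fun setT (fun z : Rd R d * Rd R d => eucl z.1 z.2).
Proof.
apply: (measurableT_comp (continuous_measurable_fun (@sqrt_continuous R))).
apply: measurable_sum => i; apply: measurable_funX; apply: measurable_funB.
- by apply: (measurableT_comp (measurable_coord i)).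
- by apply: (measurableT_comp (measurable_coord i)).
Qed.

(** Balls of row vectors are taken coordinatewise, so a ball of radius [h] lies in the closed box of
    half-width [h]; compactness leaves finitely many of them. *)
Lemma compact_box_cover (Omega : set 'rV[R]_d) h : 0 < h -> compact Omega ->
  exists (K : nat) (c : nat -> 'rV[R]_d), forall x, Omega x ->
    exists2 k, (k < K)%N & box (c k - const_mx h) (c k + const_mx h) x.
Proof.
move=> h0; rewrite compact_cover => cO.
have [||D _ OD] := cO _ [set: 'rV[R]_d] (fun c => (ball c h)°).
- by move=> c _; exact: open_interior.
- by move=> x Ox; exists x => //; exact: nbhsx_ballx.
exists (size (finmap.enum_fset D)), (nth 0 (finmap.enum_fset D)) => x.
move=> /OD [c/= cD /interior_subset cx].
exists (index c (finmap.enum_fset D)); first by rewrite index_mem.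
move=> i; rewrite nth_index// !mxE.
have := cx.2 0 i; rewrite /ball/= => /ltW; rewrite distrC ler_distl.
by [].
Qed.

Lemma fine_partition (Omega : set 'rV[R]_d) e : 0 < e -> compact Omega ->
  exists (K : nat) (A : nat -> set (Rd R d)) (c : nat -> 'rV[R]_d),
    [/\ forall k, measurable (A k), trivIset setT A,
        forall x, Omega x -> exists2 k, (k < K)%N & A k x
      & forall k x, A k x -> eucl (c k) x <= e].
Proof.
(* A box of half-width [h] has Euclidean radius at most [d * h <= e]; [d.+1] keeps the divisor
   nonzero. *)
move=> e0 cO; pose h := e / d.+1%:R.
have h0 : 0 < h by rewrite divr_gt0.
have [K [c cP]] := compact_box_cover _ _ h0 cO.
pose B k : set (Rd R d) := box (c k - const_mx h) (c k + const_mx h).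
have mB k : measurable (B k) by apply: sub_sigma_algebra; do 2 eexists.
exists K, (seqDU B), c; split.
- by move=> k; apply: measurableD => //; exact: bigsetU_measurable.
- exact: trivIset_seqDU.
- move=> x /cP [k kK Bkx].
  (* The cell of [x] in the disjointified sequence is the one of the first box that contains [x]. *)
  have ex : exists k, `[< B k x >] by exists k; exact/asboolP.
  have [m /asboolP Bm mmin] := ex_minnP ex.
  exists m; first by apply: leq_ltn_trans kK; exact/mmin/asboolP.
  split => //; rewrite -bigcup_mkord => -[j /= jm Bj].
  by have := mmin j; rewrite leqNgt jm => /(_ (asboolT Bj)).
- move=> k x [Bkx _].
  apply: le_trans (eucl_le_coord _ _ _ (ltW h0) _) _.
    by move=> i; have := Bkx i; rewrite !mxE -ler_distl distrC.
  rewrite /h mulrCA ler_piMr//; first exact: ltW.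
  by rewrite ler_pdivrMr// mul1r ler_nat.
Qed.

End eucl.

(** * Couplings with prescribed block masses *)

Lemma measure_partition (d : measure_display) (T : measurableType d)
    (R : realType) (Q : {measure set T -> \bar R}) (A : nat -> set T) (K : nat)
    (S : set T) :
  (forall k, measurable (A k)) -> trivIset setT A ->
  Q (~` \big[setU/set0]_(k < K) A k) = 0%E -> measurable S ->
  (\sum_(k < K) Q (S `&` A k) = Q S)%E.
Proof.
move=> mA tA Q0 mS.
have mU : measurable (\big[setU/set0]_(k < K) A k) by exact: bigsetU_measurable.
rewrite (measureDI _ mS mU) setDE [X in (X + _)%E](_ : _ = 0%E) ?add0e; last first.
  apply/eqP; rewrite -measure_le0 -Q0 le_measure//.
    by apply: mem_set; apply: measurableI => //; exact: measurableC.
  by apply: mem_set; exact: measurableC.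
rewrite big_distrr/= measure_bigsetU_ord//.
  by move=> i; exact: measurableI.
apply/trivIsetP => i j _ _ ij; rewrite setIACA.
by move/trivIsetP : tA => ->//; rewrite setI0.
Qed.

(** A bound on [D] alone suffices, since the restricted measure does not charge the complement of
    [D]. *)
Lemma integral_mrestr_le (d : measure_display) (T : measurableType d)
    (R : realType) (mu : {measure set T -> \bar R}) (D : set T)
    (mD : measurable D) (g : T -> R) (c : R) :
  measurable_fun setT g -> (forall x, 0 <= g x) -> 0 <= c ->
  (forall x, D x -> g x <= c) ->
  (\int[mrestr mu mD]_x (g x)%:E <= c%:E * mu D)%E.
Proof.
move=> mg g0 c0 gc.
have -> : (c%:E * mu D = \int[mrestr mu mD]_x (cst c%:E x))%E.
  by rewrite integral_cst//= /mrestr setTI.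
apply: ae_ge0_le_integral => //=.
- by move=> x _; rewrite lee_fin.
- exact/measurable_EFinP.
- exists (~` D); split; first exact: measurableC.
  + by rewrite /= /mrestr setICl measure0.
  + move=> x /= /not_implyP[_ h]; apply: contra_not h => Dx.
    by rewrite lee_fin gc.
Qed.

Section coupling_weights.
Context (R : realFieldType) (K : nat).
Variables (m : nat -> nat -> R) (q p : nat -> R).
Hypothesis m0 : forall a b, 0 <= m a b.
Hypothesis row : forall a, (a < K)%N -> \sum_(b < K) m a b = q a.
Hypothesis col : forall b, (b < K)%N -> \sum_(a < K) m a b = p b.

Lemma coupling_le_row a b : (a < K)%N -> (b < K)%N -> m a b <= q a.
Proof.
by move=> aK bK; rewrite -row// (bigD1 (Ordinal bK))//= lerDl sumr_ge0.
Qed.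

Lemma coupling_le_col a b : (a < K)%N -> (b < K)%N -> m a b <= p b.
Proof.
by move=> aK bK; rewrite -col// (bigD1 (Ordinal aK))//= lerDl sumr_ge0.
Qed.

(* Holds also when [q a * p b = 0], where the quotient is [0] and so is [m a
   b]. *)
Lemma coupling_weightK a b : (a < K)%N -> (b < K)%N ->
  m a b / (q a * p b) * (q a * p b) = m a b.
Proof.
move=> aK bK; have [|z] := eqVneq (q a * p b) 0; last by rewrite divfK.
move/eqP; rewrite mulf_eq0 => /orP[] /eqP z; rewrite z ?mul0r ?mulr0;
  apply/eqP; rewrite eq_le m0/= -z.
- exact: coupling_le_row.
- exact: coupling_le_col.
Qed.

(** This yields the marginals of the block coupling, with [s] the mass of the part of cell [a]
    inside a test set. If [q a = 0], the bound on [s] forces [s = 0]. *)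
Lemma sum_coupling_weight a s : (a < K)%N -> 0 <= s <= q a ->
  \sum_(b < K) m a b / (q a * p b) * (s * p b) = s.
Proof.
move=> aK /andP[s0 sq].
have [q0|qn0] := eqVneq (q a) 0.
  have -> : s = 0 by apply/eqP; rewrite eq_le s0 andbT -q0.
  by rewrite big1// => b _; rewrite mul0r mulr0.
transitivity (\sum_(b < K) m a b * (s / q a)); last first.
  by rewrite -mulr_suml row// mulrCA mulfV// mulr1.
apply: eq_bigr => b _; rewrite -[in RHS](coupling_weightK a b)//.
by move: (m a b / _) => w; field.
Qed.

End coupling_weights.

(* [gamma] has density [m a b / (Q1 (A a) * Q2 (B b))] with respect to [Q1 \x
   Q2] on the block [A a `*` B b]. *)
Lemma block_coupling (d1 d2 : measure_display) (T1 : measurableType d1)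
    (T2 : measurableType d2) (R : realType) (Q1 : probability T1 R)
    (Q2 : probability T2 R) (K : nat) (A : nat -> set T1) (B : nat -> set T2)
    (m : nat -> nat -> R) :
  (forall k, measurable (A k)) -> trivIset setT A ->
  Q1 (~` \big[setU/set0]_(k < K) A k) = 0%E ->
  (forall k, measurable (B k)) -> trivIset setT B ->
  Q2 (~` \big[setU/set0]_(k < K) B k) = 0%E ->
  (forall a b, 0 <= m a b) ->
  (forall a, (a < K)%N -> \sum_(b < K) m a b = fine (Q1 (A a))) ->
  (forall b, (b < K)%N -> \sum_(a < K) m a b = fine (Q2 (B b))) ->
  exists gamma : {measure set (T1 * T2)%type -> \bar R},
    [/\ forall S, measurable S -> gamma (S `*` setT) = Q1 S,
        forall S, measurable S -> gamma (setT `*` S) = Q2 S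
      & forall (g : T1 * T2 -> R) (c : nat -> nat -> R),
          measurable_fun setT g -> (forall z, 0 <= g z) ->
          (forall a b, 0 <= c a b) ->
          (forall a b z, A a z.1 -> B b z.2 -> g z <= c a b) ->
          (\int[gamma]_z (g z)%:E <=
            (\sum_(a < K) \sum_(b < K) m a b * c a b)%:E)%E].
Proof.
move=> mA tA A0 mB tB B0 m0 row col.
pose q a := fine (Q1 (A a)); pose p b := fine (Q2 (B b)).
have w0 a b : 0 <= m a b / (q a * p b).
  by rewrite divr_ge0// mulr_ge0// fine_ge0.
pose piece a b : {measure set (T1 * T2)%type -> \bar R} :=
  mscale (NngNum (w0 a b)) (mrestr (Q1 \x Q2)%E (measurableX (mA a) (mB b))).
pose gamma : {measure set (T1 * T2)%type -> \bar R} :=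
  msum (fun a => msum (piece a) K : {measure set (T1 * T2)%type -> \bar R}) K.
have gammaX S S' : measurable S -> measurable S' ->
    gamma (S `*` S') = (\sum_(a < K) \sum_(b < K) m a b / (q a * p b) *
      (fine (Q1 (S `&` A a)) * fine (Q2 (S' `&` B b))))%:E.
  move=> mS mS'; rewrite /gamma/= /msum -sumEFin.
  apply: eq_bigr => a _; rewrite -sumEFin; apply: eq_bigr => b _.
  rewrite /= /mscale/= /mrestr -setXI [RHS]EFinM; congr (_ * _)%E.
  have mSA : measurable (S `&` A a) by exact: measurableI.
  have mSB : measurable (S' `&` B b) by exact: measurableI.
  by rewrite product_measure1E// EFinM !fineK// fin_num_measure.
have fineS dd (TT : measurableType dd) (Q : probability TT R) S C :
    measurable S -> measurable C -> 0 <= fine (Q (S `&` C)) <= fine (Q C).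
  move=> mS mC; have mSC : measurable (S `&` C) by exact: measurableI.
  rewrite fine_ge0//= fine_le ?fin_num_measure//.
  by apply: le_measure; [exact: mem_set|exact: mem_set|exact: subIsetr].
exists gamma; split.
- move=> S mS; rewrite gammaX//.
  under eq_bigr => a _ do under eq_bigr => b _ do rewrite setTI.
  under eq_bigr => a _ do rewrite (@sum_coupling_weight _ K m q p)//= ?fineS//.
  rewrite -sumEFin -(measure_partition _ _ _ _ A K)//.
  by apply: eq_bigr => a _; rewrite fineK// fin_num_measure//; exact: measurableI.
- move=> S mS; rewrite gammaX// exchange_big/=.
  (* The second marginal is the first one for the transposed plan, once the products are
     commuted. *)
  under eq_bigr => b _ do under eq_bigr => a _ do
    rewrite setTI [q a * p b]mulrC [fine (Q1 _) * _]mulrC.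
  under eq_bigr => b _ do
    rewrite (@sum_coupling_weight _ K (fun b a => m a b) p q)//= ?fineS//.
  rewrite -sumEFin -(measure_partition _ _ _ _ B K)//.
  by apply: eq_bigr => a _; rewrite fineK// fin_num_measure//; exact: measurableI.
- move=> g c mg g0 c0 gc; rewrite /gamma.
  have mEg : measurable_fun setT (EFin \o g) by exact/measurable_EFinP.
  have Eg0 z : setT z -> (0 <= (g z)%:E)%E by rewrite lee_fin.
  rewrite ge0_integral_measure_sum// -sumEFin; apply: lee_sum => a _.
  rewrite ge0_integral_measure_sum// -sumEFin; apply: lee_sum => b _.
  rewrite ge0_integral_mscale//=.
  (* On each block the integrand is at most [c a b], and weight times product mass is [m a b]. *)
  apply: (@le_trans _ _ ((m a b / (q a * p b))%:E *
      ((c a b)%:E * (q a * p b)%:E))%E).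
    apply: lee_pmul => //.
    + by rewrite lee_fin.
    + exact: integral_ge0.
    have -> : ((q a * p b)%:E = (Q1 \x Q2) (A a `*` B b))%E.
      by rewrite product_measure1E// EFinM !fineK// fin_num_measure.
    apply: integral_mrestr_le => // z [Az Bz]; exact: gc Az Bz.
  rewrite -!EFinM lee_fin mulrCA [leLHS]mulrC [X in X * _](@coupling_weightK _ K)//.
Qed.

(** * Discretised mean distance and discrete transport plans *)

(* The integral of a nonnegative function is a supremum over the simple
   functions below it, hence monotone also on nonmeasurable functions; the
   inner integral of [mean_dist] may be one, as [lam] is an arbitrary measure.
   *)
Lemma le_ge0_integral (d : measure_display) (T : measurableType d)
    (R : realType) (mu : {measure set T -> \bar R}) (f g : T -> \bar R) :
  (forall x, (0 <= f x)%E) -> (forall x, (f x <= g x)%E) ->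
  (\int[mu]_x f x <= \int[mu]_x g x)%E.
Proof.
move=> f0 fg; rewrite !ge0_integralTE//; last first.
  by move=> x; exact: le_trans (f0 x) (fg x).
by apply: le_ereal_sup => _ [h /= hf <-]; exists h => // x; exact: le_trans (fg x).
Qed.

Lemma sum_indic_partition (T : Type) (R : realType) (A : nat -> set T)
    (K : nat) (x : T) : trivIset setT A -> (exists2 k, (k < K)%N & A k x) ->
  \sum_(k < K) \1_(A k) x = 1 :> R.
Proof.
move=> tA [k kK Akx]; rewrite (bigD1 (Ordinal kK))//= big1 ?addr0 => [|j jk].
  by rewrite indicE mem_set.
rewrite indicE memNset// => Ajx.
suff jE : nat_of_ord j = k by move: jk; rewrite -val_eqE/= jE eqxx.
by apply: tA => //; exists x.
Qed.

(** The integrand is dominated by a finite sum of products of a function of [x] and a function of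
    [y], whose iterated integral is computed term by term. *)
Lemma mean_dist_le (R : realType) (d : nat)
    (lam : {measure set (Rd R d) -> \bar R}) (phiP phiD : Rd R d -> R)
    (A : nat -> set (Rd R d)) (K : nat) (c : nat -> nat -> R) (p q : nat -> R) :
  measurable_fun setT phiP -> (forall x, 0 <= phiP x) ->
  measurable_fun setT phiD -> (forall x, 0 <= phiD x) ->
  (forall k, measurable (A k)) ->
  (forall x, phiP x != 0 -> exists2 k, (k < K)%N & A k x) ->
  (forall x, phiD x != 0 -> exists2 k, (k < K)%N & A k x) ->
  (forall a b, 0 <= c a b) ->
  (forall a b x y, A a x -> A b y -> eucl x y <= c a b) ->
  (forall a, \int[lam]_(x in A a) (phiP x)%:E = (p a)%:E)%E ->
  (forall b, \int[lam]_(x in A b) (phiD x)%:E = (q b)%:E)%E ->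
  (mean_dist lam phiP phiD <=
    (\sum_(a < K) \sum_(b < K) p a * q b * c a b)%:E)%E.
Proof.
move=> mP P0 mD D0 mA covP covD c0 Ac ip iq.
pose F (phi : Rd R d -> R) k x : R := \1_(A k) x * phi x.
have F0 phi k x : (forall x, 0 <= phi x) -> 0 <= F phi k x.
  by move=> phi0; rewrite mulr_ge0// indicE ler0n.
have mF phi k : measurable_fun setT phi -> measurable_fun setT (F phi k).
  by move=> mphi; apply: measurable_funM => //; exact: measurable_indic.
have iF phi k r : (\int[lam]_(x in A k) (phi x)%:E = r%:E)%E ->
    (\int[lam]_x (F phi k x)%:E = r%:E)%E.
  move=> <-; rewrite [RHS]integral_mkcond; apply: eq_integral => x _.
  by rewrite patchE /F indicE; case: ifP => _; rewrite ?mul1r ?mul0r.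
pose J := ('I_K * 'I_K)%type.
apply: (@le_trans _ _ (\int[lam]_x \int[lam]_y
    (\sum_(ab : J) (c ab.1 ab.2 * F phiP ab.1 x)%:E * (F phiD ab.2 y)%:E))%E).
  apply: le_ge0_integral => x.
    by apply: integral_ge0 => y _; rewrite lee_fin !mulr_ge0 ?eucl_ge0.
  apply: le_ge0_integral => y.
    by rewrite lee_fin !mulr_ge0 ?eucl_ge0.
  under eq_bigr do rewrite -EFinM.
  rewrite sumEFin lee_fin.
  have sum0 (Q : pred J) :
      0 <= \sum_(ab : J | Q ab) c ab.1 ab.2 * F phiP ab.1 x * F phiD ab.2 y.
    by apply: sumr_ge0 => ab _; rewrite !mulr_ge0 ?F0.
  have [->|/covP[a aK Aax]] := eqVneq (phiP x) 0.
    by rewrite mulr0 mul0r (le_trans _ (sum0 xpredT)).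
  have [->|/covD[b bK Aby]] := eqVneq (phiD y) 0.
    by rewrite mulr0 (le_trans _ (sum0 xpredT)).
  (* The term of a pair of cells containing [x] and [y] already dominates; the others are
     nonnegative. *)
  rewrite (bigD1 ((Ordinal aK, Ordinal bK) : J))//=.
  rewrite -[leLHS]addr0 lerD//.
  by rewrite /F !indicE !mem_set//= !mul1r !ler_wpM2r// Ac.
have mEF phi k : measurable_fun setT phi ->
    measurable_fun setT (fun x => (F phi k x)%:E).
  by move=> ?; apply/measurable_EFinP; exact: mF.
under eq_integral => x _.
  rewrite ge0_integral_sum//; last 2 first.
  - by move=> ab; apply: measurable_funeM; exact: mEF.
  - by move=> ab y _; rewrite mule_ge0// lee_fin ?mulr_ge0 ?F0.
  under eq_bigr => ab _.
    rewrite ge0_integralZl_EFin//; last 3 first.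
    - by move=> y _; rewrite lee_fin F0.
    - exact: mEF.
    - by rewrite mulr_ge0 ?F0.
    rewrite (iF _ _ _ (iq _)) -EFinM mulrAC EFinM.
    over.
  over.
rewrite ge0_integral_sum//; last 2 first.
- by move=> ab; apply: measurable_funeM; exact: mEF.
- move=> ab y _; rewrite mule_ge0// lee_fin ?F0//.
  by rewrite mulr_ge0// -lee_fin -iq integral_ge0// => z _; rewrite lee_fin.
rewrite pair_bigA/= -sumEFin; apply: lee_sum => ab _.
have q0 : 0 <= q ab.2.
  by rewrite -lee_fin -iq integral_ge0// => z _; rewrite lee_fin.
rewrite ge0_integralZl_EFin//.
- by rewrite (iF _ _ _ (ip _)) -EFinM lee_fin le_eqVlt; apply/orP; left; apply/eqP; ring.
- by move=> y _; rewrite lee_fin F0.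
- exact: mEF.
- by rewrite mulr_ge0.
Qed.

(* The witness is [(1 - delta) m + r s^T / delta], where [r] and [s] are the
   marginals missing from [(1 - delta) m], each of total mass [delta]. *)
Lemma transport_repair (R : realFieldType) (K : nat) (m : nat -> nat -> R)
    (q' p' q p : nat -> R) (delta : R) :
  0 < delta -> delta < 1 ->
  (forall a b, 0 <= m a b) ->
  (forall a, (a < K)%N -> \sum_(b < K) m a b = q' a) ->
  (forall b, (b < K)%N -> \sum_(a < K) m a b = p' b) ->
  \sum_(a < K) q' a = 1 -> \sum_(b < K) p' b = 1 ->
  \sum_(a < K) q a = 1 -> \sum_(b < K) p b = 1 ->
  (forall a, (a < K)%N -> (1 - delta) * q' a <= q a) ->
  (forall b, (b < K)%N -> (1 - delta) * p' b <= p b) ->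
  exists m' : nat -> nat -> R,
    [/\ forall a b, 0 <= m' a b,
        forall a, (a < K)%N -> \sum_(b < K) m' a b = q a,
        forall b, (b < K)%N -> \sum_(a < K) m' a b = p b
      & forall a b, m' a b <= m a b + delta].
Proof.
move=> d0 d1 m0 row col sq' sp' sq sp hq hp.
pose r a := q a - (1 - delta) * q' a; pose s b := p b - (1 - delta) * p' b.
have r0 a : (a < K)%N -> 0 <= r a by move=> aK; rewrite subr_ge0 hq.
have s0 b : (b < K)%N -> 0 <= s b by move=> bK; rewrite subr_ge0 hp.
have sr : \sum_(a < K) r a = delta.
  by rewrite /r sumrB -mulr_sumr sq sq'; ring.
have ss : \sum_(b < K) s b = delta.
  by rewrite /s sumrB -mulr_sumr sp sp'; ring.
(* Setting [m'] to [0] outside the range gives nonnegativity for all indices; [r] and [s] are known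
   to be nonnegative only below [K]. *)
pose m' a b := if (a < K)%N && (b < K)%N then
  (1 - delta) * m a b + r a * s b / delta else 0.
have m'E a b : (a < K)%N -> (b < K)%N ->
    m' a b = (1 - delta) * m a b + r a * s b / delta.
  by move=> aK bK; rewrite /m' aK bK.
have dn0 : delta != 0 by rewrite gt_eqF.
exists m'; split.
- move=> a b; rewrite /m'; case: ifP => // /andP[aK bK].
  by rewrite addr_ge0 ?mulr_ge0 ?invr_ge0 ?r0 ?s0 ?m0 ?subr_ge0 ?(ltW d0) ?(ltW d1).
- move=> a aK; under eq_bigr do rewrite m'E//.
  rewrite big_split/= -mulr_sumr -mulr_suml -mulr_sumr row// ss mulfK//.
  by rewrite /r; ring.
- move=> b bK; under eq_bigr do rewrite m'E//.
  rewrite big_split/= -mulr_sumr -mulr_suml -mulr_suml col// sr mulrAC mulfV//.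
  by rewrite /s; ring.
- move=> a b; rewrite /m'; case: ifP => [/andP[aK bK]|_]; last first.
    by rewrite addr_ge0// ltW.
  (* Both deficits are at most their total [delta], so the correction [r a * s b / delta] is at most
     [delta]. *)
  have rd : r a <= delta.
    rewrite -sr (bigD1 (Ordinal aK))//= lerDl sumr_ge0// => i _; exact: r0.
  have sd : s b <= delta.
    rewrite -ss (bigD1 (Ordinal bK))//= lerDl sumr_ge0// => i _; exact: s0.
  rewrite lerD//.
    by rewrite ler_piMl// gerBl ltW.
  by rewrite ler_pdivrMr// ler_pM// ?r0 ?s0.
Qed.

(** * Tours as transport plans *)

Lemma limn_einf_ge (R : realType) (u : (\bar R)^nat) (z : \bar R) :
  (\forall n \near \oo, (z <= u n)%E) -> (z <= limn_einf u)%E.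
Proof.
move=> [N _ zu]; rewrite limn_einf_lim; apply: lime_ge; first exact: is_cvg_einfs.
exists N => // n /= Nn; apply: le_ereal_inf_tmp => _ [k /= nk <-].
by apply: zu => /=; exact: leq_trans Nn nk.
Qed.

Lemma sc_opt_attained (R : realType) (d n : nat) (x y : nat -> 'rV[R]_d) :
  exists s : 'S_n, sc_opt n x y = sc_tour_length x y s.
Proof.
rewrite /sc_opt; elim/big_ind: _ => [|u v [s ->] [t ->]|s _].
- by exists 1%g.
- by rewrite minEle; case: ifP => _; [exists s|exists t].
- by exists s.
Qed.

Section tour.
Context (R : realType) (d : nat) (A : nat -> set (Rd R d)) (K : nat).
Variables (c : nat -> nat -> R) (h : R).
Hypothesis tA : trivIset setT A.
Hypothesis Ac : forall a b x y, A a x -> A b y -> c a b - h <= eucl x y.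

(** The double sum selects [c] at the cells of [x] and [y]. In this form, linear in products of
    indicators, averaging over the legs produces frequencies of pairs of cells. *)
Lemma cell_dist_le x y :
  (exists2 k, (k < K)%N & A k x) -> (exists2 k, (k < K)%N & A k y) ->
  \sum_(a < K) \sum_(b < K) \1_(A a) x * \1_(A b) y * c a b - h <= eucl x y.
Proof.
move=> xA yA.
have s1 (r : R) : r = \sum_(a < K) \sum_(b < K) \1_(A a) x * \1_(A b) y * r.
  rewrite -[LHS]mul1r -{1}(sum_indic_partition _ R A K x tA xA) mulr_suml.
  apply: eq_bigr => a _; rewrite -mulr_suml -mulr_sumr.
  by rewrite (sum_indic_partition _ R A K y tA yA) mulr1.
rewrite lerBlDr [leRHS]s1; apply: ler_sum => a _; apply: ler_sum => b _.
rewrite !indicE; case: (boolP (x \in A a)) => xa; last by rewrite !mul0r.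
case: (boolP (y \in A b)) => yb; last by rewrite mulr0 !mul0r.
by rewrite !mul1r -lerBlDr; apply: Ac; exact: set_mem.
Qed.

(** The plan [m a b] is the fraction of empty legs from a delivery in cell [a] to a pickup in cell
    [b]. The error [h] is paid once for loaded legs and once for empty ones. *)
Lemma tour_transport (n : nat) (x y : nat -> 'rV[R]_d) (s : 'S_n) :
  (0 < n)%N ->
  (forall i, exists2 k, (k < K)%N & A k (x i)) ->
  (forall i, exists2 k, (k < K)%N & A k (y i)) ->
  exists m : nat -> nat -> R,
    [/\ forall a b, 0 <= m a b,
        forall a, \sum_(b < K) m a b = (\sum_(i < n) \1_(A a) (y i)) / n%:R,
        forall b, \sum_(a < K) m a b = (\sum_(i < n) \1_(A b) (x i)) / n%:R
      & \sum_(a < K) \sum_(b < K)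
          (\sum_(i < n) \1_(A a) (x i) * \1_(A b) (y i)) / n%:R * c a b
        + \sum_(a < K) \sum_(b < K) m a b * c a b - 2 * h
        <= sc_tour_length x y s / n%:R].
Proof.
move=> n0 xA yA.
have n0' : 0 < n%:R :> R by rewrite ltr0n.
pose m a b : R :=
  (\sum_(k < n) \1_(A a) (y (s k)) * \1_(A b) (x (s (ordS k)))) / n%:R.
(* Used twice: for the loaded legs with identity indexing, and for the empty legs with [s] and its
   cyclic shift. *)
have avg (u v : nat -> 'rV[R]_d) :
    (forall i, exists2 k, (k < K)%N & A k (u i)) ->
    (forall i, exists2 k, (k < K)%N & A k (v i)) ->
    forall s1 s2 : 'I_n -> 'I_n,
    \sum_(a < K) \sum_(b < K)
      (\sum_(k < n) \1_(A a) (u (s1 k)) * \1_(A b) (v (s2 k))) / n%:R * c a b - h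
    <= (\sum_(k < n) eucl (u (s1 k)) (v (s2 k))) / n%:R.
  move=> uA vA s1 s2; rewrite ler_pdivlMr//.
  have -> : (\sum_(a < K) \sum_(b < K)
      (\sum_(k < n) \1_(A a) (u (s1 k)) * \1_(A b) (v (s2 k))) / n%:R * c a b
      - h) * n%:R = \sum_(k < n) (\sum_(a < K) \sum_(b < K)
        \1_(A a) (u (s1 k)) * \1_(A b) (v (s2 k)) * c a b - h).
    rewrite sumrB sumr_const card_ord mulrBl [h * _]mulr_natr; congr (_ - _).
    rewrite [RHS]exchange_big/= mulr_suml; apply: eq_bigr => a _.
    rewrite [RHS]exchange_big/= mulr_suml; apply: eq_bigr => b _.
    by rewrite -[RHS]mulr_suml mulrAC divfK// gt_eqF.
  by apply: ler_sum => k _; exact: cell_dist_le.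
exists m; split.
- move=> a b; rewrite divr_ge0//; apply: sumr_ge0 => k _.
  by rewrite mulr_ge0// indicE ler0n.
- move=> a; rewrite -mulr_suml exchange_big/=; congr (_ / _).
  rewrite [RHS](reindex_inj (@perm_inj _ s))/=; apply: eq_bigr => k _.
  by rewrite -mulr_sumr (sum_indic_partition _ R A K _ tA (xA _)) mulr1.
- move=> b; rewrite -mulr_suml exchange_big/=; congr (_ / _).
  (* The cyclic successor is injective, so every pickup ends exactly one empty leg. *)
  rewrite [RHS](reindex_inj (inj_comp (@perm_inj _ s) (@ordS_inj n)))/=.
  apply: eq_bigr => k _.
  by rewrite -mulr_suml (sum_indic_partition _ R A K _ tA (yA _)) mul1r.
- have h1 := avg x y xA yA id id.
  have h2 := avg y x yA xA s (fun k => s (ordS k)).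
  rewrite /sc_tour_length big_split/= [leRHS]mulrDl.
  have -> : \sum_(k < n) eucl (x (s k)) (y (s k)) =
      \sum_(i < n) eucl (x i) (y i) by rewrite [RHS](reindex_inj (@perm_inj _ s)).
  apply: le_trans (lerD h1 h2).
  by rewrite le_eqVlt; apply/orP; left; apply/eqP; rewrite /m; ring.
Qed.

End tour.

(** * Almost sure limits of the frequencies of pairs of cells *)

Section frequencies.
Context (R : realType) (d : nat) (dT : measure_display) (T : measurableType dT).
Variables (P : probability T R) (X Y : nat -> T -> Rd R d).
Variables (QX QY : probability (Rd R d) R).
Hypothesis mX : forall i, measurable_fun setT (X i).
Hypothesis mY : forall i, measurable_fun setT (Y i).
Hypothesis PX : forall i S, measurable S -> P (X i @^-1` S) = QX S.
Hypothesis PY : forall i S, measurable S -> P (Y i @^-1` S) = QY S.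
Hypothesis indep : mutually_independent P
  (fun k : nat + nat => match k with inl i => X i | inr j => Y j end).

(** The strong law applies to the events that [X i] is in [S] and [Y i] in [S']; their pairwise
    independence is mutual independence of four variables. *)
Lemma pair_frequency (S S' : set (Rd R d)) : measurable S -> measurable S' ->
  {ae P, forall w, (\sum_(i < n) \1_S (X i w) * \1_S' (Y i w)) / n%:R
    @[n --> \oo] --> fine (QX S) * fine (QY S')}.
Proof.
move=> mS mS'.
pose E i := X i @^-1` S `&` Y i @^-1` S'.
have mE i : measurable (E i).
  by apply: measurableI; rewrite -[X in measurable X]setTI;
    [exact: mX | exact: mY].
pose B (k : nat + nat) := if k is inl _ then S else S'.
have mB k : measurable (B k) by case: k.
have QXE : QX S = (fine (QX S))%:E by rewrite fineK// fin_num_measure.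
have QYE : QY S' = (fine (QY S'))%:E by rewrite fineK// fin_num_measure.
have PE i : P (E i) = (fine (QX S) * fine (QY S'))%:E.
  have := indep [:: inl i; inr i] B isT mB.
  rewrite !big_cons !big_nil setIT mule1 /= => ->.
  by rewrite PX// PY// EFinM -QXE -QYE.
have PEE i j : i != j -> P (E i `&` E j) = ((fine (QX S) * fine (QY S')) ^+ 2)%:E.
  move=> ij; have := indep [:: inl i; inr i; inl j; inr j] B _ mB.
  rewrite !big_cons !big_nil setIT mule1 /= => h.
  rewrite /E -setIA h; last first.
    have nl : inl i != inl j :> nat + nat by apply: contra_neq ij => -[].
    have nr : inr i != inr j :> nat + nat by apply: contra_neq ij => -[].
    by rewrite /= !inE (negbTE nl) (negbTE nr).
  by rewrite !PX// !PY// expr2 !EFinM -QXE -QYE muleA.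
have := slln_events _ _ _ _ _ _ mE PE PEE.
apply: filterS => w; apply: cvg_trans; apply: near_eq_cvg; near=> n.
by rewrite /count_events; congr (_ / _); apply: eq_bigr => i _; rewrite indicI.
Unshelve. all: by end_near.
Qed.

End frequencies.

(** * The lower bound *)

Lemma ae_notin (R : realType) (d : nat) (dT : measure_display)
    (T : measurableType dT) (P : probability T R) (Z : nat -> T -> Rd R d)
    (S : set (Rd R d)) : measurable S -> (forall i, measurable_fun setT (Z i)) ->
  (forall i, P (Z i @^-1` S) = 0%E) ->
  {ae P, forall w, forall i, ~ S (Z i w)}.
Proof.
move=> mS mZ PZ; apply: ae_foralln => i; exists (Z i @^-1` S); split => //.
- by rewrite -[X in measurable X]setTI; exact: mZ.
- exact: PZ.
- by move=> w /= /contrapT.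
Qed.

Lemma integral_density_eq0 (R : realType) (d : nat)
    (lam : {measure set (Rd R d) -> \bar R}) (Omega : set 'rV[R]_d)
    (phi : Rd R d -> R) (S : set (Rd R d)) :
  is_density_on lam Omega phi -> (forall x, S x -> ~ Omega x) ->
  (\int[lam]_(x in S) (phi x)%:E = 0)%E.
Proof.
move=> [_ _ phi0 _] SO; apply: integral0_eq => x Sx.
by rewrite phi0//; exact: SO.
Qed.

(** The factor [1 - delta] leaves room below [l] when [l > 0]. There is none when [l = 0], hence the
    assumption that [u] then vanishes identically. *)
Lemma eventually_scaled_le (R : realType) (u : nat -> R) (l delta : R) :
  0 < delta -> 0 <= l -> u n @[n --> \oo] --> l -> (l = 0 -> forall n, u n = 0) ->
  \forall n \near \oo, (1 - delta) * u n <= l.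
Proof.
move=> d0 l0 ul u0; have [l0'|ln0] := eqVneq l 0.
  by near=> n; rewrite u0// mulr0.
have lgt : (1 - delta) * l < l.
  by rewrite mulrBl mul1r gtrBl mulr_gt0// lt_neqAle eq_sym ln0.
have cv : (1 - delta) * u n @[n --> \oo] --> (1 - delta) * l by exact: cvgMr.
have h : 0 < l - (1 - delta) * l by rewrite subr_gt0.
move/cvgrPdist_le : cv => /(_ _ h); apply: filterS => n.
by rewrite ler_distlC => /andP[_]; rewrite addrCA subrr addr0.
Unshelve. all: by end_near.
Qed.

Section lower_bound.
Context (R : realType) (d : nat) (Omega : set 'rV[R]_d).
Hypothesis cOmega : compact Omega.
Context (lam : {measure set (Rd R d) -> \bar R}) (phiP phiD : Rd R d -> R).
Hypothesis hphiP : is_density_on lam Omega phiP.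
Hypothesis hphiD : is_density_on lam Omega phiD.
Context (dT : measure_display) (T : measurableType dT) (P : probability T R)
  (X Y : nat -> T -> Rd R d).
Hypothesis hX : forall i, has_density P lam phiP (X i).
Hypothesis hY : forall i, has_density P lam phiD (Y i).
Hypothesis hind : mutually_independent P
  (fun k : nat + nat => match k with inl i => X i | inr j => Y j end).

(** The loss [10 * e] consists of [8 * e] from replacing distances by cell costs on both kinds of
    legs, [e] from the pair frequencies and [e] from repairing the plan. *)
Lemma tour_liminf_approx (e : R) : 0 < e ->
  {ae P, forall w,
    (mean_dist lam phiP phiD + wasserstein lam phiD phiP - (10 * e)%:E <=
     limn_einf (fun n : nat =>
       (sc_opt n (fun i => X i w) (fun i => Y i w) / n%:R)%:E))%E}.
Proof.
move=> e0.
have [K [A [ctr [mA tA cov ctrP]]]] := fine_partition _ _ _ _ e0 cOmega.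
(* The shift by [2 * e] makes [c] an upper bound for distances between cells, as the mean distance
   and the coupling cost require; the lower bound is then [c - 4 * e]. *)
pose c a b : R := eucl (ctr a) (ctr b) + 2 * e.
have c0 a b : 0 <= c a b by rewrite addr_ge0 ?eucl_ge0// mulr_ge0// ltW.
have c_ub a b x y : A a x -> A b y -> eucl x y <= c a b.
  move=> /ctrP ax /ctrP yb.
  have := eucl_triangle _ _ x (ctr a) y.
  have := eucl_triangle _ _ (ctr a) (ctr b) y.
  by rewrite (eucl_sym _ _ x (ctr a)) /c; lra.
have c_lb a b x y : A a x -> A b y -> c a b - 4 * e <= eucl x y.
  move=> /ctrP ax /ctrP yb.
  have := eucl_triangle _ _ (ctr a) x (ctr b).
  have := eucl_triangle _ _ x y (ctr b).
  by rewrite (eucl_sym _ _ y (ctr b)) /c; lra.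
have mX i : measurable_fun setT (X i) := (hX i).1.
have mY i : measurable_fun setT (Y i) := (hY i).1.
pose QX : probability (Rd R d) R := distribution P (mfun_Sub (mem_set (mX 0%N))).
pose QY : probability (Rd R d) R := distribution P (mfun_Sub (mem_set (mY 0%N))).
have QXE S : measurable S -> QX S = (\int[lam]_(x in S) (phiP x)%:E)%E.
  by move=> mS; exact: (hX 0%N).2.
have QYE S : measurable S -> QY S = (\int[lam]_(x in S) (phiD x)%:E)%E.
  by move=> mS; exact: (hY 0%N).2.
have PX i S : measurable S -> P (X i @^-1` S) = QX S.
  by move=> mS; rewrite QXE//; exact: (hX i).2.
have PY i S : measurable S -> P (Y i @^-1` S) = QY S.
  by move=> mS; rewrite QYE//; exact: (hY i).2.
pose U := \big[setU/set0]_(k < K) A k.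
have mU : measurable U by exact: bigsetU_measurable.
have mUC : measurable (~` U) by exact: measurableC.
have UP x : U x -> exists2 k, (k < K)%N & A k x.
  by rewrite /U -bigcup_mkord => -[k /= kK Akx]; exists k.
have UO x : (~` U) x -> ~ Omega x.
  move=> nU Ox; apply: nU; have [k kK Akx] := cov x Ox.
  by rewrite /U -bigcup_mkord; exists k.
have QX0 : QX (~` U) = 0%E.
  by rewrite QXE//; apply: integral_density_eq0 hphiP UO.
have QY0 : QY (~` U) = 0%E.
  by rewrite QYE//; apply: integral_density_eq0 hphiD UO.
pose p a := fine (QX (A a)); pose q b := fine (QY (A b)).
have pE a : QX (A a) = (p a)%:E by rewrite fineK// fin_num_measure.
have qE a : QY (A a) = (q a)%:E by rewrite fineK// fin_num_measure.
have sum1 (Q : probability (Rd R d) R) : Q (~` U) = 0%E ->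
    \sum_(k < K) fine (Q (A k)) = 1.
  move=> Q0; apply: EFin_inj; rewrite -sumEFin -(@probability_setT _ _ _ Q).
  rewrite -(measure_partition _ _ _ Q A K setT mA tA Q0)//.
  by apply: eq_bigr => k _; rewrite setTI fineK// fin_num_measure.
pose M := \sum_(a < K) \sum_(b < K) p a * q b * c a b.
have mean_le : (mean_dist lam phiP phiD <= M%:E)%E.
  have [mP P0 PO _] := hphiP; have [mD D0 DO _] := hphiD.
  apply: (@mean_dist_le _ _ _ _ _ A) => //.
  - move=> x Px; apply: cov; apply: contrapT => /PO Px0.
    by rewrite Px0 eqxx in Px.
  - move=> x Px; apply: cov; apply: contrapT => /DO Px0.
    by rewrite Px0 eqxx in Px.
  - by move=> a; rewrite -QXE// pE.
  - by move=> a; rewrite -QYE// qE.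
have W_le (m : nat -> nat -> R) : (forall a b, 0 <= m a b) ->
    (forall a, (a < K)%N -> \sum_(b < K) m a b = q a) ->
    (forall b, (b < K)%N -> \sum_(a < K) m a b = p b) ->
    (wasserstein lam phiD phiP <=
      (\sum_(a < K) \sum_(b < K) m a b * c a b)%:E)%E.
  move=> m0 row col.
  have [gamma [g1 g2 gc]] :=
    block_coupling _ _ _ _ _ QY QX K A A m mA tA QY0 mA tA QX0 m0 row col.
  apply: (@le_trans _ _ (\int[gamma]_z (eucl z.1 z.2)%:E)%E).
    apply: ereal_inf_lbound; exists gamma => //; split => S mS.
    - by rewrite g1// QYE.
    - by rewrite g2// QXE.
  apply: gc => //; first exact: measurable_eucl.
  - by move=> z; exact: eucl_ge0.
  - by move=> a b z; exact: c_ub.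
pose C := \sum_(a < K) \sum_(b < K) c a b.
have C0 : 0 <= C by apply: sumr_ge0 => a _; apply: sumr_ge0.
(* Chosen so that [delta < 1] and the total repair cost [delta * C] is at most [e]. *)
pose delta := e / (1 + e + C).
have den0 : 0 < 1 + e + C by lra.
have d0 : 0 < delta by rewrite divr_gt0.
have d1 : delta < 1 by rewrite ltr_pdivrMr//; lra.
have dC : delta * C <= e.
  by rewrite /delta mulrAC ler_pdivrMr//; nra.
have aeXU := ae_notin _ _ _ _ P X (~` U) mUC mX (fun i => etrans (PX i _ mUC) QX0).
have aeYU := ae_notin _ _ _ _ P Y (~` U) mUC mY (fun i => etrans (PY i _ mUC) QY0).
(* Cells of probability zero are almost surely never visited, which settles the case of limit [0] in
   [eventually_scaled_le]. *)
have aeX0 : {ae P, forall w, forall a, p a = 0 -> forall i, ~ A a (X i w)}.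
  apply: ae_foralln => a; have [pa0|pan0] := eqVneq (p a) 0; last first.
    by apply: aeW => w pa0; rewrite pa0 eqxx in pan0.
  have := ae_notin _ _ _ _ P X (A a) (mA a) mX
    (fun i => etrans (PX i _ (mA a)) (etrans (pE a) (congr1 EFin pa0))).
  by apply: filterS => w.
have aeY0 : {ae P, forall w, forall a, q a = 0 -> forall i, ~ A a (Y i w)}.
  apply: ae_foralln => a; have [qa0|qan0] := eqVneq (q a) 0; last first.
    by apply: aeW => w qa0; rewrite qa0 eqxx in qan0.
  have := ae_notin _ _ _ _ P Y (A a) (mA a) mY
    (fun i => etrans (PY i _ (mA a)) (etrans (qE a) (congr1 EFin qa0))).
  by apply: filterS => w.
have freq := pair_frequency _ _ _ _ P X Y QX QY mX mY PX PY hind.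
have aeXY : {ae P, forall w, forall a b,
    (\sum_(i < n) \1_(A a) (X i w) * \1_(A b) (Y i w)) / n%:R
      @[n --> \oo] --> p a * q b}.
  by apply: ae_foralln => a; apply: ae_foralln => b; exact: freq.
have QT (Q : probability (Rd R d) R) : fine (Q setT) = 1.
  by rewrite probability_setT.
(* Single frequencies are pair frequencies with the whole space as the other set. *)
have aeX : {ae P, forall w, forall a,
    (\sum_(i < n) \1_(A a) (X i w)) / n%:R @[n --> \oo] --> p a}.
  apply: ae_foralln => a; have := freq (A a) setT (mA a) measurableT.
  apply: filterS => w; rewrite QT mulr1; apply: cvg_trans.
  apply: near_eq_cvg; near=> n; congr (_ / _); apply: eq_bigr => i _.
  by rewrite indicT mulr1.
have aeY : {ae P, forall w, forall a,
    (\sum_(i < n) \1_(A a) (Y i w)) / n%:R @[n --> \oo] --> q a}.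
  apply: ae_foralln => a; have := freq setT (A a) measurableT (mA a).
  apply: filterS => w; rewrite QT mul1r; apply: cvg_trans.
  apply: near_eq_cvg; near=> n; congr (_ / _); apply: eq_bigr => i _.
  by rewrite indicT mul1r.
(* From here on the sample path is fixed and the argument is deterministic. *)
near=> w.
have cvX a : (\sum_(i < n) \1_(A a) (X i w)) / n%:R @[n --> \oo] --> p a.
  by move: a; near: w; exact: aeX.
have cvY a : (\sum_(i < n) \1_(A a) (Y i w)) / n%:R @[n --> \oo] --> q a.
  by move: a; near: w; exact: aeY.
have cvXY a b : (\sum_(i < n) \1_(A a) (X i w) * \1_(A b) (Y i w)) / n%:R
    @[n --> \oo] --> p a * q b by move: a b; near: w; exact: aeXY.
have nullX a : p a = 0 -> forall i, ~ A a (X i w).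
  by move: a; near: w; exact: aeX0.
have nullY a : q a = 0 -> forall i, ~ A a (Y i w).
  by move: a; near: w; exact: aeY0.
have xA i : exists2 k, (k < K)%N & A k (X i w).
  by apply: UP; apply: contrapT; move: i; near: w; exact: aeXU.
have yA i : exists2 k, (k < K)%N & A k (Y i w).
  by apply: UP; apply: contrapT; move: i; near: w; exact: aeYU.
pose fX n a : R := (\sum_(i < n) \1_(A a) (X i w)) / n%:R.
pose fY n a : R := (\sum_(i < n) \1_(A a) (Y i w)) / n%:R.
have evX : \forall n \near \oo, forall a : 'I_K, (1 - delta) * fX n a <= p a.
  apply: filter_forall => a.
  apply: (eventually_scaled_le _ (fun n => fX n a)) => //.
  - by rewrite fine_ge0.
  - exact: cvX.
  - move=> pa0 n; rewrite /fX big1 ?mul0r// => i _; rewrite indicE memNset//.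
    exact: nullX.
have evY : \forall n \near \oo, forall a : 'I_K, (1 - delta) * fY n a <= q a.
  apply: filter_forall => a.
  apply: (eventually_scaled_le _ (fun n => fY n a)) => //.
  - by rewrite fine_ge0.
  - exact: cvY.
  - move=> qa0 n; rewrite /fY big1 ?mul0r// => i _; rewrite indicE memNset//.
    exact: nullY.
pose F n := \sum_(a < K) \sum_(b < K)
  (\sum_(i < n) \1_(A a) (X i w) * \1_(A b) (Y i w)) / n%:R * c a b.
have evF : \forall n \near \oo, M - e <= F n.
  have : F n @[n --> \oo] --> M.
    apply: cvg_big => [|a _]; first exact: add_continuous.
    apply: cvg_big => [|b _]; first exact: add_continuous.
    by apply: cvgMl; exact: cvXY.
  by move=> /cvgrPdist_le/(_ _ e0); apply: filterS => n; rewrite ler_distlC => /andP[].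
apply: limn_einf_ge.
near=> n.
have hfX : forall a : 'I_K, (1 - delta) * fX n a <= p a by near: n.
have hfY : forall a : 'I_K, (1 - delta) * fY n a <= q a by near: n.
have hF : M - e <= F n by near: n.
have n0 : (0 < n)%N by near: n; exact: nbhs_infty_gt.
have [s ->] := sc_opt_attained R d n (fun i => X i w) (fun i => Y i w).
have [m [m0 row col tour]] := tour_transport _ _ A K c (4 * e) tA c_lb n
  (fun i => X i w) (fun i => Y i w) s n0 xA yA.
have avg1 (Z : nat -> Rd R d) : (forall i, exists2 k, (k < K)%N & A k (Z i)) ->
    \sum_(a < K) (\sum_(i < n) \1_(A a) (Z i)) / n%:R = 1 :> R.
  move=> ZA; rewrite -mulr_suml exchange_big/=.
  under eq_bigr do rewrite (sum_indic_partition _ R A K _ tA (ZA _)).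
  by rewrite sumr_const card_ord mulfV// pnatr_eq0 -lt0n.
(* Rows stand for deliveries and columns for pickups; the empirical marginals [fY n] and [fX n] are
   replaced by the exact [q] and [p]. *)
have [m' [m'0 row' col' m'le]] := @transport_repair R K m (fY n) (fX n) q p
  delta d0 d1 m0 (fun a _ => row a) (fun b _ => col b) (avg1 _ yA) (avg1 _ xA)
  (sum1 _ QY0) (sum1 _ QX0) (fun a aK => hfY (Ordinal aK))
  (fun b bK => hfX (Ordinal bK)).
rewrite leeBlDr//; apply: le_trans (leeD mean_le (W_le m' m'0 row' col')) _.
rewrite -!EFinD lee_fin.
have : \sum_(a < K) \sum_(b < K) m' a b * c a b <=
    \sum_(a < K) \sum_(b < K) m a b * c a b + delta * C.
  rewrite /C mulr_sumr -big_split/=; apply: ler_sum => a _.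
  rewrite mulr_sumr -big_split/=; apply: ler_sum => b _.
  by rewrite -mulrDl ler_wpM2r.
rewrite -/(F n) in tour; lra.
Unshelve. all: by end_near.
Qed.

End lower_bound.

Theorem theorem2 (R : realType) (d : nat) (hd : (2 <= d)%N)
    (Omega : set 'rV[R]_d) (hOmega : compact Omega)
    (lam : {measure set (Rd R d) -> \bar R}) (hlam : is_lebesgue lam)
    (phiP phiD : Rd R d -> R)
    (hphiP : is_density_on lam Omega phiP) (hphiD : is_density_on lam Omega phiD)
    (dT : measure_display) (T : measurableType dT) (P : probability T R)
    (X Y : nat -> T -> Rd R d)
    (hX : forall i, has_density P lam phiP (X i))
    (hY : forall i, has_density P lam phiD (Y i))
    (hind : mutually_independent P
              (fun k : nat + nat => match k with inl i => X i | inr j => Y j end)) :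
  {ae P, forall w : T,
    (mean_dist lam phiP phiD + wasserstein lam phiD phiP <=
     limn_einf (fun n : nat =>
       (sc_opt n (fun i => X i w) (fun i => Y i w) / n%:R)%:E))%E}.
Proof.
(* The null set depends on the error, so only the countably many errors [harmonic k] are used; one
   of them is below [e / 10] for any given [e]. *)
have := ae_foralln (fun k => tour_liminf_approx R d Omega hOmega lam phiP phiD
  hphiP hphiD dT T P X Y hX hY hind (harmonic k) (harmonic_gt0 k)).
apply: filterS => w hw; apply/lee_subgt0Pr => e e0.
have e10 : 0 < e / 10 by rewrite divr_gt0.
have /cvgrPdist_le/(_ _ e10)[k _ /(_ k (leqnn k))] := @cvg_harmonic R.
rewrite sub0r normrN ger0_norm ?harmonic_ge0// ler_pdivlMr// => ke.
apply: le_trans (hw k); rewrite leeB// lee_fin; lra.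
Qed.
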